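(* Let $n\ge 3$ and let $CH_n$ be the closed helm graph. Then $$cn_{\chi}(CH_n)=\begin{cases} n, & n \text{ even},\\ n-1, & n\text{ odd},\end{cases} \qquad\text{and}\qquad cn^c_{\chi}(CH_n)=\begin{cases} n^2, & n \text{ even},\\ 2(n-1)^2, & n\text{ odd}.\end{cases}$$
   Context: All graphs are finite, simple, undirected and connected. A chromatic colouring of a graph $G$ is a proper vertex colouring with exactly $\chi(G)$ colours $c_1,\ldots,c_\ell$, $\ell=\chi(G)$; the colour class of $c_i$ is denoted $\mathcal{C}_i$ and $\theta(c_i)=|\mathcal{C}_i|$. A $\chi^-$-colouring of $G$ is a chromatic colouring in which the maximum possible number of vertices gets colour $c_1$, then (subject to that) the maximum possible number of the remaining vertices gets $c_2$, then the maximum possible number of the remaining vertices gets $c_3$, and so on; that is, $(\theta(c_1),\ldots,\theta(c_\ell))$ is lexicographically maximal among all chromatic colourings of $G$. With respect to a $\chi^-$-colouring, the chromatic curling number is $cn_{\chi}(G)=\max\{\theta(c_i):1\le i\le \ell\}$ and the chromatic compound curling number is $cn^c_{\chi}(G)=\prod_{i=1}^{\ell}\theta(c_i)$. The helm graph $H_n$ is obtained from the wheel consisting of a rim cycle $v_1v_2\cdots v_nv_1$ and a central vertex $v$ adjacent to all $v_i$, by attaching to each $v_i$ a pendant vertex $u_i$. The closed helm graph $CH_n$ is obtained from $H_n$ by adding the edges of the cycle $u_1u_2\cdots u_nu_1$ on the pendant vertices. *)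

(* Defs.v *)
From HB Require Import structures.
From mathcomp Require Import all_boot all_order.

Set Implicit Arguments.
Unset Strict Implicit.
Unset Printing Implicit Defensive.

Import Order.TTheory.

Record graph := Graph {
  vertex :> finType;
  adj : rel vertex;
  adj_sym : symmetric adj;
  adj_irrefl : irreflexive adj;
  adj_connected : forall x y : vertex, connect adj x y
}.

Section Colourings.

Variable G : graph.

Definition proper_colouring k (c : {ffun G -> 'I_k}) : bool :=
  [forall x, forall y, adj x y ==> (c x != c y)].

Definition exact_colouring k (c : {ffun G -> 'I_k}) : bool :=
  proper_colouring c && [forall i, exists x, c x == i].

Lemma ex_exact_colouring :
  exists k, [exists c : {ffun G -> 'I_k}, exact_colouring c].
Proof.
exists #|G|; apply/existsP; exists [ffun x : G => enum_rank x].
apply/andP; split.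
- apply/forallP => x; apply/forallP => y; apply/implyP => xy.
  rewrite !ffunE (inj_eq enum_rank_inj).
  by apply: contraTneq xy => ->; rewrite adj_irrefl.
- apply/forallP => i; apply/existsP; exists (enum_val i).
  by rewrite ffunE enum_valK.
Qed.

Definition chromatic_number : nat := ex_minn ex_exact_colouring.

(* The colour c_(i+1) is the ordinal i. *)
Definition colouring : predArgType := {ffun G -> 'I_chromatic_number}.

Definition chromatic_colouring (c : colouring) : bool := exact_colouring c.

Definition colour_class (c : colouring) (i : 'I_chromatic_number) : {set G} :=
  [set x | c x == i].

Definition theta (c : colouring) (i : 'I_chromatic_number) : nat :=
  #|colour_class c i|.

(* The type carries the lexicographic order. *)
Definition theta_tuple (c : colouring) : chromatic_number.-tuplelexi nat :=
  [tuple theta c i | i < chromatic_number].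

Definition chi_minus_colouring (c : colouring) : bool :=
  chromatic_colouring c &&
  [forall d, chromatic_colouring d ==> (theta_tuple d <= theta_tuple c)%O].

Lemma ex_chi_minus_colouring : exists c, chi_minus_colouring c.
Proof.
have [c0 c0P] : exists c, chromatic_colouring c.
  rewrite /chromatic_colouring /colouring /chromatic_number.
  by case: ex_minnP => k /existsP.
case: (@arg_maxP _ _ _ c0 chromatic_colouring theta_tuple c0P) => c cP cmax.
exists c; apply/andP; split=> //.
by apply/forallP => d; apply/implyP => /cmax.
Qed.

Definition curling_number (c : colouring) : nat := \max_i theta c i.

Definition compound_curling_number (c : colouring) : nat := \prod_i theta c i.

Definition some_chi_minus_colouring : colouring := xchoose ex_chi_minus_colouring.

Definition cn_chi : nat := curling_number some_chi_minus_colouring.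

Definition cnc_chi : nat := compound_curling_number some_chi_minus_colouring.

Lemma chi_minus_theta (c d : colouring) :
  chi_minus_colouring c -> chi_minus_colouring d -> theta c =1 theta d.
Proof.
move=> /andP[cP /forallP cmax] /andP[dP /forallP dmax] i.
have e : theta_tuple c = theta_tuple d.
  by apply/le_anti; rewrite (implyP (dmax c)) ?(implyP (cmax d)).
by have /(congr1 (fun t : _.-tuple nat => tnth t i)) := e; rewrite !tnth_mktuple.
Qed.

(* The two numbers do not depend on the colouring chosen above. *)
Lemma cn_chiE (c : colouring) :
  chi_minus_colouring c -> cn_chi = curling_number c.
Proof.
by move=> cP; apply: eq_bigr => i _; apply: chi_minus_theta (xchooseP _) cP _.
Qed.

Lemma cnc_chiE (c : colouring) :
  chi_minus_colouring c -> cnc_chi = compound_curling_number c.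
Proof.
by move=> cP; apply: eq_bigr => i _; apply: chi_minus_theta (xchooseP _) cP _.
Qed.

End Colourings.

Section ClosedHelm.

Variable n : nat.

(* ordS is the cyclic successor; i != j only matters for n = 1, where it
   excludes a loop. *)
Definition cycle_adj : rel 'I_n :=
  fun i j => (i != j) && ((j == ordS i) || (i == ordS j)).

(* None is the hub v, Some (inl i) is the rim vertex v_(i+1) and Some (inr i)
   is the pendant vertex u_(i+1). *)
Definition helm_vertex : predArgType := option ('I_n + 'I_n).

Definition helm_adj : rel helm_vertex := fun x y =>
  match x, y with
  | None, Some (inl _) | Some (inl _), None => true
  | Some (inl i), Some (inl j) => cycle_adj i j
  | Some (inl i), Some (inr j) | Some (inr i), Some (inl j) => i == j
  | _, _ => false
  end.

Definition closed_helm_adj : rel helm_vertex := fun x y =>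
  helm_adj x y ||
  match x, y with
  | Some (inr i), Some (inr j) => cycle_adj i j
  | _, _ => false
  end.

Lemma cycle_adj_sym : symmetric cycle_adj.
Proof. by move=> i j; rewrite /cycle_adj eq_sym orbC. Qed.

Lemma closed_helm_sym : symmetric closed_helm_adj.
Proof.
by move=> [[i|i]|] [[j|j]|] //;
  rewrite /closed_helm_adj /= ?(cycle_adj_sym i) // eq_sym.
Qed.

Lemma closed_helm_irrefl : irreflexive closed_helm_adj.
Proof. by move=> [[i|i]|] //; rewrite /closed_helm_adj /= /cycle_adj eqxx. Qed.

Lemma closed_helm_connected (x y : helm_vertex) : connect closed_helm_adj x y.
Proof.
have hub z : connect closed_helm_adj z None.
  case: z => [[i|i]|]; [exact: connect1| |exact: connect0].
  apply: (@connect_trans _ _ (Some (inl i))); apply: connect1 => //.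
  by rewrite /closed_helm_adj /= eqxx.
apply: connect_trans (hub x) _.
by rewrite (sym_connect_sym closed_helm_sym).
Qed.

Definition closed_helm : graph :=
  Graph closed_helm_sym closed_helm_irrefl closed_helm_connected.

End ClosedHelm.

(* Main.v *)
Require Import Defs.
From mathcomp Require Import all_boot all_order.
From mathcomp Require Import zify.

(** An independent subset of the cycle [C_n] has at most [h := n./2] elements,
  so an independent set of [CH_n] has at most [h + h] elements if it avoids the
  hub, and at most [1 + h] if it contains it; hence every colour class has at
  most [2h] elements. The hub and the rim force [n <= (k - 1) * h] for [k]
  colours, that is [k >= 3] for even [n] and [k >= 4] for odd [n]. Colouring
  both cycles alternately, in opposite phase, leaves only the hub (and, for odd
  [n], one rim vertex and its pendant vertex) for the other colours. As the class
  sizes add up to [2n + 1], the first two classes then have exactly [2h]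
  elements, and the sizes [(n, n, 1)] and [(n - 1, n - 1, 2, 1)] are
  lexicographically maximal. *)

Set Implicit Arguments.
Unset Strict Implicit.
Unset Printing Implicit Defensive.

Import Order.TTheory.

(** * Class sizes of colourings with an arbitrary number of colours *)

Section ClassSizes.

Variable G : graph.

(** This is [theta] with the number of colours left free, so that it applies to colourings in ['I_3]
    or ['I_4] before the chromatic number is known. *)
Definition class_size k (c : {ffun G -> 'I_k}) (i : 'I_k) : nat :=
  #|[set x | c x == i]|.

Lemma sum_class_size k (c : {ffun G -> 'I_k}) : \sum_i class_size c i = #|G|.
Proof.
rewrite -sum1_card (partition_big c xpredT) //=; apply: eq_bigr => i _.
by rewrite /class_size -sum1_card; apply: eq_bigl => x; rewrite inE.
Qed.

Lemma exact_class_size_gt0 k (c : {ffun G -> 'I_k}) i :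
  exact_colouring c -> 0 < class_size c i.
Proof.
case/andP=> _ /forallP /(_ i) /existsP [x xi].
by apply/card_gt0P; exists x; rewrite inE.
Qed.

Lemma exact_of_class_size k (c : {ffun G -> 'I_k}) :
  proper_colouring c -> (forall i, 0 < class_size c i) -> exact_colouring c.
Proof.
move=> cP c_gt0; rewrite /exact_colouring cP /=; apply/forallP=> i.
by have /card_gt0P [x] := c_gt0 i; rewrite inE => xi; apply/existsP; exists x.
Qed.

Lemma proper_neq k (c : {ffun G -> 'I_k}) x y :
  proper_colouring c -> adj x y -> c x != c y.
Proof. by move=> /forallP /(_ x) /forallP /(_ y) /implyP. Qed.

(** The first two hypotheses identify [chromatic_number G] with [k]. Substituting it for [k] makes
    [c] a [colouring G], and the third hypothesis then says that [c] is a chi-minus colouring. *)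
Lemma curling_numbers_witness k (c : {ffun G -> 'I_k}) :
  exact_colouring c ->
  (forall m (d : {ffun G -> 'I_m}), exact_colouring d -> k <= m) ->
  (forall d : {ffun G -> 'I_k}, exact_colouring d ->
    ([seq class_size d i | i : 'I_k] <= [seq class_size c i | i : 'I_k]
       :> seqlexi nat)%O) ->
  cn_chi G = \max_i class_size c i /\ cnc_chi G = \prod_i class_size c i.
Proof.
move=> cP kmin cmax; have chi : chromatic_number G = k.
  rewrite /chromatic_number; case: ex_minnP => m /existsP [d dP] mmin.
  apply/eqP; rewrite eqn_leq (kmin _ d dP) andbT.
  by apply: mmin; apply/existsP; exists c.
subst k.
have cm : chi_minus_colouring c.
  apply/andP; split=> //; apply/forallP => d; apply/implyP => /cmax.
  exact.
by split; [exact: cn_chiE | exact: cnc_chiE].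
Qed.

End ClassSizes.

(** * Independent sets in a cycle *)

Lemma val_ordS n (i : 'I_n) : ordS i = (if i.+1 == n then 0 else i.+1) :> nat.
Proof.
case: i => i /= i_lt; case: eqP => [->|ni]; first exact: modnn.
by rewrite modn_small //; lia.
Qed.

(** The image of [S] under the injective successor has the size of [S] and is disjoint from it, so
    twice that size is at most [n]. For [1 < n] no index is its own successor. *)
Lemma cycle_independent n (S : {set 'I_n}) : 1 < n ->
  {in S &, forall i j, ~~ cycle_adj i j} -> #|S| <= n./2.
Proof.
move=> n_gt1 Sind.
have dis : [disjoint S & [set ordS i | i in S]].
  rewrite -setI_eq0; apply/set0Pn => -[j /setIP [jS /imsetP [i iS e]]].
  move: (Sind _ _ iS jS); rewrite e /cycle_adj eqxx andbT negbK => /eqP.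
  by move/(congr1 (@nat_of_ord n)); rewrite val_ordS; case: eqP; lia.
have : #|S :|: [set ordS i | i in S]| <= #|'I_n| := max_card _.
rewrite cardsU (disjoint_setI0 dis) cards0 subn0 card_ord.
by rewrite (card_imset _ (@ordS_inj _)) addnn => /half_leq; rewrite doubleK.
Qed.

(** * Bounds on independent sets and on proper colourings of the closed helm *)

Section ClosedHelmColourings.

Variable n : nat.
Hypothesis n_ge3 : 3 <= n.

Notation CH := (closed_helm n).

Definition rim (A : {set CH}) : {set 'I_n} := [set i | Some (inl i) \in A].
Definition pendant (A : {set CH}) : {set 'I_n} := [set i | Some (inr i) \in A].

Lemma card_closed_helm_set (A : {set CH}) :
  #|A| = (None \in A) + (#|rim A| + #|pendant A|).
Proof.
rewrite -sum1_card big_mkcond (bigD1 None) //=.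
rewrite (reindex_omap Some id) /=; last by case.
rewrite (eq_bigl xpredT) => [|i]; last by rewrite eqxx.
rewrite big_sumType /= -!big_mkcond -!sum1_card; congr (_ + (_ + _)).
- by apply: eq_bigl => i; rewrite inE.
- by apply: eq_bigl => i; rewrite inE.
Qed.

Lemma card_closed_helm : #|CH| = (2 * n).+1.
Proof. by rewrite card_option card_sum card_ord addnn mul2n. Qed.

Definition independent (A : {set CH}) : Prop :=
  {in A &, forall x y, ~~ closed_helm_adj x y}.

Lemma rim_independent (A : {set CH}) : independent A -> #|rim A| <= n./2.
Proof.
move=> Aind; apply: cycle_independent; first lia.
move=> i j; rewrite !inE => iA jA.
by have := Aind _ _ iA jA; rewrite /closed_helm_adj /= orbF.
Qed.

Lemma pendant_independent (A : {set CH}) :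
  independent A -> #|pendant A| <= n./2.
Proof.
move=> Aind; apply: cycle_independent; first lia.
by move=> i j; rewrite !inE => iA jA; have := Aind _ _ iA jA.
Qed.

Lemma rim_hub (A : {set CH}) : independent A -> None \in A -> rim A = set0.
Proof.
move=> Aind hA; apply/setP => i; rewrite !inE; apply/negP => iA.
by have := Aind _ _ hA iA.
Qed.

Lemma card_independent (A : {set CH}) : independent A -> #|A| <= n./2.*2.
Proof.
move=> Aind; rewrite card_closed_helm_set.
have := pendant_independent Aind; have := rim_independent Aind.
case hA: (None \in A); last lia.
(* The bound is now [1 + n./2], and [n_ge3] gives [1 <= n./2]. *)
by rewrite (rim_hub Aind hA) cards0; lia.
Qed.

Section Bounds.

Variables (k : nat) (d : {ffun CH -> 'I_k}).
Hypothesis dP : proper_colouring d.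

Lemma class_independent i : independent [set x | d x == i].
Proof.
move=> x y; rewrite !inE => /eqP xi /eqP yi; apply/negP => xy.
by have := proper_neq dP xy; rewrite xi yi eqxx.
Qed.

Lemma class_size_le i : class_size d i <= n./2.*2.
Proof. exact/card_independent/class_independent. Qed.

(* The hub's colour does not occur on the rim. *)
Lemma closed_helm_colours_ge : 3 + odd n <= k.
Proof.
pose r i := #|rim [set x | d x == i]|.
have rimE : \sum_i r i = n.
  rewrite -[RHS]card_ord -sum1_card.
  rewrite (partition_big (fun j : 'I_n => d (Some (inl j))) xpredT) //=.
  apply: eq_bigr => i _; rewrite /r -sum1_card.
  by apply: eq_bigl => j; rewrite !inE.
have hub0 : r (d None) = 0.
  by rewrite /r (rim_hub (@class_independent _)) ?cards0 // inE.
have : \sum_(i | i != d None) r i <= \sum_(i | i != d None) n./2.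
  by apply: leq_sum => i _; apply/rim_independent/class_independent.
move: rimE; rewrite (bigD1 (d None)) //= hub0 add0n => ->.
rewrite sum_nat_const cardC1 card_ord => n_le.
have n2 := odd_double_half n.
(* Here [n <= k.-1 * n./2]. For even [n], [k <= 2] would give [n <= n./2]; for odd [n], [k <= 3]
   would give [n <= n./2.*2 = n - 1]. *)
by case: (odd n) n2 => /= n2; case: k n_le => [|[|[|[|]]]] //=; lia.
Qed.

End Bounds.

(** * The alternating colouring and its small classes *)

(** For odd [n] the last rim vertex sees 0 and 1 on the rim and 2 at the hub, hence gets 3; its
    pendant vertex is not adjacent to the hub and can share the hub's colour. *)
Definition alternating_colour (x : CH) : nat :=
  match x with
  | None => 2
  | Some (inl i) => if odd n && (i.+1 == n) then 3 else odd i
  | Some (inr i) => if odd n && (i.+1 == n) then 2 else ~~ odd i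
  end.

Lemma alternating_colour_lt x : alternating_colour x < 3 + odd n.
Proof.
case: x => [[i|i]|] /=; last by case: (odd n).
  by case: (odd n); case: (i.+1 == n); case: (odd i).
by case: (odd n); case: (i.+1 == n); case: (odd i).
Qed.

Lemma cycle_adj_neq (f : 'I_n -> nat) :
  (forall i, f i != f (ordS i)) -> forall i j, cycle_adj i j -> f i != f j.
Proof.
by move=> fS i j /andP[_ /orP[] /eqP ->]; rewrite // eq_sym.
Qed.

Lemma alternating_colour_proper (x y : CH) :
  adj x y -> alternating_colour x != alternating_colour y.
Proof.
move: x y => [[i|i]|] [[j|j]|]; rewrite /= /closed_helm_adj //= ?orbF.
- move: i j; apply: cycle_adj_neq => i; rewrite val_ordS.
  have := ltn_ord i; case: (eqVneq i.+1 n) => [ni _|_ _] /=; last first.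
    by rewrite andbF; case: ifP => _; case: (odd i).
  (* At the wrap-around the successor is vertex 0, which is not the last one and keeps its parity
     colour. For even [n] the last index is odd, so the colours differ. *)
  rewrite andbT (_ : 1 == n = false) ?andbF; last lia.
  by move: (congr1 odd ni) => /= <-; case: (odd i).
- by move=> /eqP ->; case: ifP => _ //; case: (odd j).
- by case: ifP => _ //; case: (odd i).
- by move=> /eqP ->; case: ifP => _ //; case: (odd j).
- move: i j; apply: cycle_adj_neq => i; rewrite val_ordS.
  have := ltn_ord i; case: (eqVneq i.+1 n) => [ni _|_ _] /=; last first.
    by rewrite andbF; case: ifP => _; case: (odd i).
  rewrite andbT (_ : 1 == n = false) ?andbF; last lia.
  by move: (congr1 odd ni) => /= <-; case: (odd i).
- by case: ifP => _ //; case: (odd j).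
Qed.

Section AlternatingColouring.

Variable k : nat.
Hypothesis k_eq : k.+1 = 3 + odd n.

(** Keeping [k] with an equation lets the two parities use the literal types ['I_3] and ['I_4], over
    which sums and products unfold. *)
Definition alternating_colouring : {ffun CH -> 'I_k.+1} :=
  [ffun x => inord (alternating_colour x)].

Lemma alternating_colouringE x :
  alternating_colouring x = alternating_colour x :> nat.
Proof. by rewrite ffunE inordK // k_eq alternating_colour_lt. Qed.

Lemma alternating_colouring_proper : proper_colouring alternating_colouring.
Proof.
apply/forallP => x; apply/forallP => y; apply/implyP => /alternating_colour_proper.
by rewrite -!alternating_colouringE.
Qed.

Lemma mem_alternating_class x i :
  (x \in [set y | alternating_colouring y == i]) = (alternating_colour x == i).
Proof. by rewrite inE -alternating_colouringE. Qed.

Lemma card_last : #|[set i : 'I_n | i.+1 == n]| = 1.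
Proof.
have lt_n : n.-1 < n by lia.
apply/eqP/cards1P; exists (Ordinal lt_n); apply/setP => i.
by rewrite !inE -val_eqE /=; lia.
Qed.

(** Only the classes of 2 and 3 are counted directly; those of 0 and 1 will follow from the total
    and the upper bound. *)
Lemma alternating_class_size2 (i : 'I_k.+1) :
  i = 2 :> nat -> class_size alternating_colouring i = 1 + odd n.
Proof.
move=> i2; rewrite /class_size card_closed_helm_set mem_alternating_class i2 /=.
congr (_ + _); rewrite (_ : rim _ = set0) ?cards0 ?add0n; last first.
  apply/setP => j; rewrite in_set mem_alternating_class inE i2 /=.
  by case: ifP => _ //; case: (odd j).
case: (boolP (odd n)) => n_odd.
  rewrite -[RHS]card_last; apply: eq_card => j.
  rewrite in_set mem_alternating_class inE i2 /= n_odd /=.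
  by case: (j.+1 == n) => //; case: (odd j).
rewrite (_ : pendant _ = set0) ?cards0 //; apply/setP => j.
rewrite in_set mem_alternating_class inE i2 /= (negbTE n_odd) /=.
by case: (odd j).
Qed.

Lemma alternating_class_size3 (i : 'I_k.+1) :
  i = 3 :> nat -> class_size alternating_colouring i = 1.
Proof.
move=> i3; have n_odd : odd n by have := ltn_ord i; rewrite i3 k_eq; case: (odd n).
rewrite /class_size card_closed_helm_set mem_alternating_class i3 /= add0n.
rewrite (_ : pendant _ = set0) ?cards0 ?addn0; last first.
  apply/setP => j; rewrite in_set mem_alternating_class inE i3 /=.
  by case: ifP => _ //; case: (odd j).
rewrite -[RHS]card_last; apply: eq_card => j.
rewrite in_set mem_alternating_class inE i3 /= n_odd /=.
by case: (j.+1 == n) => //; case: (odd j).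
Qed.

End AlternatingColouring.

End ClosedHelmColourings.

(** * The curling numbers for each parity *)

Lemma closed_helm_even n : 3 <= n -> ~~ odd n ->
  cn_chi (closed_helm n) = n /\ cnc_chi (closed_helm n) = n ^ 2.
Proof.
move=> n_ge3 n_even; have k_eq : 3 = 3 + odd n by rewrite (negbTE n_even).
have n2 : n./2.*2 = n by rewrite even_halfK.
pose c := alternating_colouring n 2.
have c_proper : proper_colouring c by exact: alternating_colouring_proper.
have c_le := class_size_le n_ge3 c_proper; rewrite n2 in c_le.
have c2 : class_size c (lift ord0 (lift ord0 ord0)) = 1.
  by rewrite alternating_class_size2 // (negbTE n_even).
have := sum_class_size c; rewrite card_closed_helm !big_ord_recl big_ord0 c2.
move=> c_sum.
have c0 : class_size c ord0 = n.
  by have := c_le ord0; have := c_le (lift ord0 ord0); lia.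
have c1 : class_size c (lift ord0 ord0) = n by lia.
have c_exact : exact_colouring c.
  apply: exact_of_class_size => // i.
  case: (unliftP ord0 i) => [{}i|] ->; last lia.
  case: (unliftP ord0 i) => [{}i|] ->; last lia.
  by rewrite (ord1 i) c2.
have [|d d_exact|-> ->] := curling_numbers_witness c_exact.
- by move=> m d /andP[dP _]; rewrite k_eq; exact: closed_helm_colours_ge dP.
- rewrite /image_mem !enum_ordSl enum_ord0 /= c0 c1 c2.
  have d_le := class_size_le n_ge3 (proj1 (andP d_exact)); rewrite n2 in d_le.
  have d_gt0 i : 0 < class_size d i by exact: exact_class_size_gt0.
  have := sum_class_size d; rewrite card_closed_helm !big_ord_recl big_ord0.
  have := d_le ord0; have := d_le (lift ord0 ord0).
  have := d_gt0 (lift ord0 (lift ord0 ord0)).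
  (* If the first two sizes of [d] both reach [n], the total [2n + 1] leaves 1 for the third. *)
  by rewrite !lexi_cons !leEnat lexi0s; lia.
by rewrite !big_ord_recl !big_ord0 c0 c1 c2; split; lia.
Qed.

Lemma closed_helm_odd n : 3 <= n -> odd n ->
  cn_chi (closed_helm n) = n - 1 /\
  cnc_chi (closed_helm n) = 2 * (n - 1) ^ 2.
Proof.
move=> n_ge3 n_odd; have k_eq : 4 = 3 + odd n by rewrite n_odd.
have n2 : n./2.*2 = n - 1 by rewrite odd_halfK // subn1.
pose c := alternating_colouring n 3.
have c_proper : proper_colouring c by exact: alternating_colouring_proper.
have c_le := class_size_le n_ge3 c_proper; rewrite n2 in c_le.
have c2 : class_size c (lift ord0 (lift ord0 ord0)) = 2.
  by rewrite alternating_class_size2 // n_odd.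
have c3 : class_size c (lift ord0 (lift ord0 (lift ord0 ord0))) = 1.
  by rewrite alternating_class_size3.
have := sum_class_size c; rewrite card_closed_helm !big_ord_recl big_ord0 c2 c3.
move=> c_sum.
have c0 : class_size c ord0 = n - 1.
  by have := c_le ord0; have := c_le (lift ord0 ord0); lia.
have c1 : class_size c (lift ord0 ord0) = n - 1 by lia.
have c_exact : exact_colouring c.
  apply: exact_of_class_size => // i.
  case: (unliftP ord0 i) => [{}i|] ->; last lia.
  case: (unliftP ord0 i) => [{}i|] ->; last lia.
  case: (unliftP ord0 i) => [{}i|] ->; last by rewrite c2.
  by rewrite (ord1 i) c3.
have [|d d_exact|-> ->] := curling_numbers_witness c_exact.
- by move=> m d /andP[dP _]; rewrite k_eq; exact: closed_helm_colours_ge dP.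
- rewrite /image_mem !enum_ordSl enum_ord0 /= c0 c1 c2 c3.
  have d_le := class_size_le n_ge3 (proj1 (andP d_exact)); rewrite n2 in d_le.
  have d_gt0 i : 0 < class_size d i by exact: exact_class_size_gt0.
  have := sum_class_size d; rewrite card_closed_helm !big_ord_recl big_ord0.
  have := d_le ord0; have := d_le (lift ord0 ord0).
  have := d_gt0 (lift ord0 (lift ord0 (lift ord0 ord0))).
  (* If the first two sizes of [d] both reach [n - 1], the last two add up to 3; the fourth is
     positive, so the third is at most 2, and if it is 2 the fourth is 1. *)
  by rewrite !lexi_cons !leEnat lexi0s; lia.
by rewrite !big_ord_recl !big_ord0 c0 c1 c2 c3; split; lia.
Qed.

Theorem theorem5 (n : nat) (hn : 3 <= n) :
  cn_chi (closed_helm n) = (if odd n then n - 1 else n) /\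
  cnc_chi (closed_helm n) = (if odd n then 2 * (n - 1) ^ 2 else n ^ 2).
Proof.
by case: ifPn => [/(closed_helm_odd hn)|/(closed_helm_even hn)].
Qed.
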